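(* Let $n=2^t$ with $t\ge 1$ an integer. There exists a solution $I_n$ in $[n]^3$ in which the black cubes are contained in (the union of) three mutually orthogonal facial sections of $[n]^3$.
   Context: $[n]^3$ denotes the graph whose vertices (also called cubes) are the triples $(x,y,z)$ with $x,y,z\in\{1,\dots,n\}$; two vertices are neighbours if they differ in exactly one coordinate, and in that coordinate by exactly $1$. A position is any subset of the vertices of $[n]^3$; its vertices are called black. A dismantling move removes from the current position a vertex having exactly $3$ neighbours in the current position. A base position is a set of $n^2$ pairwise non-neighbouring vertices of $[n]^3$. A solution is a base position that can be obtained from the full position $[n]^3$ by a finite sequence of dismantling moves. A section is the set of $n^2$ vertices obtained by fixing one coordinate; it is facial if the fixed coordinate has value $1$ or $n$. Sections are mutually orthogonal if their fixed coordinates are different coordinates. *)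

(* Defs.v *)
From mathcomp Require Import all_boot.

Set Implicit Arguments.
Unset Strict Implicit.
Unset Printing Implicit Defensive.

(* Coordinates are numbered 0 .. 2 and take values 0 .. n-1 (instead of 1 .. n),
   so the extreme values are 0 and n.-1. *)
Definition cube (n : nat) : finType := {ffun 'I_3 -> 'I_n}.

Definition neighbour (n : nat) : rel (cube n) := fun u v =>
  [exists i : 'I_3,
     (((u i).+1 == v i :> nat) || ((v i).+1 == u i :> nat))
     && [forall j : 'I_3, (j != i) ==> (u j == v j)]].

Definition position (n : nat) : finType := {set cube n}.

Definition dismantling_move (n : nat) : rel (position n) := fun P Q =>
  [exists v : cube n,
     [&& v \in P, #|[set w in P | neighbour v w]| == 3 & Q == P :\ v]].

Definition base_position (n : nat) (P : position n) : Prop :=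
  #|P| = n ^ 2 /\ {in P &, forall u v : cube n, ~~ neighbour u v}.

Definition solution (n : nat) (P : position n) : Prop :=
  base_position P /\ connect (@dismantling_move n) [set: cube n] P.

(* The pair (c, a) stands for the section fixing coordinate c to the value a. *)
Definition section (n : nat) : Type := ('I_3 * 'I_n)%type.

Definition section_set (n : nat) (s : section n) : {set cube n} :=
  [set v : cube n | v s.1 == s.2].

Definition facial (n : nat) (s : section n) : Prop :=
  s.2 = 0 :> nat \/ s.2 = n.-1 :> nat.

Definition orthogonal (n : nat) (s s' : section n) : Prop := s.1 <> s'.1.

(* Main.v *)
(* Read backwards, a dismantling sequence adds vertices having exactly three
   neighbours.  Such a step leaves (edges) - 3 (vertices) unchanged, while adding
   a vertex with more than three neighbours increases it.  This quantity is
   -3n^2 for the full cube, and at least -3n^2 for a set of at most n^2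
   vertices.  Hence a set of at most n^2 vertices from which the full cube is
   reached by adding vertices with at least three neighbours is automatically a
   solution: it has n^2 vertices, no edges, and every step uses exactly three
   neighbours.

   With coordinates 0 .. n-1, n = 2^t, and v the 2-adic valuation (v(0) = t), take
   the points with one coordinate 0 whose two other coordinates have the same
   valuation.  In a face, the missing points with v(x) < v(y) = b form horizontal
   segments between consecutive multiples of 2^b; exactly one end of a segment
   is an odd multiple of 2^b, hence a point of the set, and the segment fills up
   from that end, since the points above and below it have smaller valuations
   and are filled before, by induction on b.  Then the three axes fill from the
   origin and the interior fills from the three faces. *)
Require Import Defs.
From mathcomp Require Import all_boot zify.

Set Implicit Arguments.
Unset Strict Implicit.
Unset Printing Implicit Defensive.

(** * Percolating sets and the edge count *)

Section Percolation.

Variable n : nat.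
Implicit Types (P Q : position n) (u v : cube n).

Definition degree_in P v := #|[set w in P | neighbour v w]|.

(** Counts ordered pairs, so every edge twice; hence the factors 6 below. *)
Definition edge_count P := \sum_(u in P) degree_in P u.

(** Phrased through closed supersets, which avoids explicit sequences of additions. *)
Definition percolates P := forall Q, P \subset Q ->
  (forall v, 2 < degree_in Q v -> v \in Q) -> Q = [set: cube n].

Lemma neighbour_sym : symmetric (@neighbour n).
Proof.
move=> u v; rewrite /neighbour; apply/eq_existsb => i.
by rewrite orbC; congr (_ && _); apply/eq_forallb => j; rewrite [v j == _]eq_sym.
Qed.

Lemma neighbour_irr : irreflexive (@neighbour n).
Proof. by move=> u; apply/negbTE/existsPn => i; rewrite orbb; lia. Qed.

Lemma degree_inE P v : degree_in P v = \sum_(w in P) neighbour v w.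
Proof.
rewrite /degree_in -sum1_card big_mkcond [RHS]big_mkcond /=.
by apply: eq_bigr => w _; rewrite inE; case: (w \in P); case: neighbour.
Qed.

Lemma degree_inU1 Q u v : v \notin Q ->
  degree_in (v |: Q) u = neighbour u v + degree_in Q u.
Proof. by move=> vQ; rewrite !degree_inE big_setU1. Qed.

Lemma edge_countU1 Q v : v \notin Q ->
  edge_count (v |: Q) = edge_count Q + (degree_in Q v).*2.
Proof.
move=> vQ; rewrite /edge_count big_setU1 //= degree_inU1 // neighbour_irr add0n.
under eq_bigr => u _ do rewrite degree_inU1 // neighbour_sym.
by rewrite big_split /= -degree_inE; lia.
Qed.

Definition step_up (i : 'I_3) u v :=
  ((u i).+1 == v i :> nat) && [forall j : 'I_3, (j != i) ==> (u j == v j)].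

Lemma neighbour_le_steps u v :
  neighbour u v <= \sum_(i < 3) (step_up i u v + step_up i v u).
Proof.
case: (boolP (neighbour u v)) => //= /existsP [i] /andP [h e].
rewrite (bigD1 i) //= /step_up e.
have -> : [forall j : 'I_3, (j != i) ==> (v j == u j)].
  by apply/forallP => j; move/forallP/(_ j): e; rewrite [u j == _]eq_sym.
by rewrite !andbT; case/orP: h => ->; lia.
Qed.

Lemma sum_step_up i u : \sum_v step_up i u v <= (u i != n.-1 :> nat).
Proof.
rewrite -(big_mkcond (step_up i u) (fun=> 1)) sum1_card.
case: (altP (u i =P n.-1 :> nat)) => [e|_] /=.
  rewrite leqn0; apply/eqP/eq_card0 => v; rewrite -topredE /= /step_up e.
  by have := ltn_ord (v i); case: eqP => //=; lia.
apply/card_le1_eqP => v w; rewrite -!topredE /= /step_up.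
move=> /andP [/eqP vi /forallP ve] /andP [/eqP wi /forallP we].
apply/ffunP => j; have := we j; have := ve j.
by case: eqP => [-> _ _|_ /eqP <- /eqP <- //]; apply: val_inj; rewrite /= -vi.
Qed.

Lemma card_cube : #|cube n| = n ^ 3.
Proof. by rewrite card_ffun !card_ord. Qed.

Lemma card_section_set (i : 'I_3) (a : 'I_n) : #|section_set (i, a)| = n ^ 2.
Proof.
have -> : #|section_set (i, a)| =
    #|family (fun j : 'I_3 => if j == i then pred1 a else predT)|.
  apply: eq_card => v; rewrite inE /=; apply/eqP/familyP => [vi j|/(_ i)].
    by case: eqP => [->|] //=; rewrite inE vi.
  by rewrite eqxx inE => /eqP.
rewrite card_family foldrE big_map big_enum /= (bigD1 i) //= eqxx card1 mul1n.
rewrite (eq_bigr (fun=> n)) => [|j /negbTE ->]; last by rewrite card_ord.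
by rewrite prod_nat_const cardC1 card_ord.
Qed.

(** Each of the three axes carries n^3 - n^2 edges, each counted twice. *)
Lemma edge_count_setT : edge_count [set: cube n] + 6 * n ^ 2 <= 6 * n ^ 3.
Proof.
case: (posnP n) => [n0|n_gt0].
  rewrite /edge_count big1 ?n0 // => u _.
  by have := leq_ltn_trans (leq0n _) (ltn_ord (u ord0)); lia.
have face i : \sum_(u : cube n) (u i != n.-1 :> nat) + n ^ 2 = n ^ 3.
  have lt_n : n.-1 < n by rewrite prednK.
  rewrite -card_cube -(cardsC (section_set (i, Ordinal lt_n))) card_section_set.
  rewrite addnC; congr (_ + _).
  rewrite -(big_mkcond (fun u : cube n => u i != n.-1 :> nat) (fun=> 1)) sum1_card.
  by apply: eq_card => u; rewrite !inE.
suff le_sum : edge_count [set: cube n] <=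
    \sum_(i < 3) (\sum_(u : cube n) (u i != n.-1 :> nat)).*2.
  have -> : 6 * n ^ 3 = \sum_(i < 3) (n ^ 3).*2.
    by rewrite sum_nat_const card_ord; lia.
  have -> : 6 * n ^ 2 = \sum_(i < 3) (n ^ 2).*2.
    by rewrite sum_nat_const card_ord; lia.
  apply: leq_trans (leq_add le_sum (leqnn _)) _; rewrite -big_split /=.
  by apply: leq_sum => i _; rewrite -doubleD face.
rewrite /edge_count.
under eq_bigr => u _ do rewrite degree_inE.
have big_setT (F : cube n -> nat) : \sum_(u in [set: cube n]) F u = \sum_u F u.
  by apply: eq_bigl => u; rewrite inE.
rewrite big_setT; under eq_bigr => u _ do rewrite big_setT.
apply: (@leq_trans (\sum_(u : cube n) \sum_(v : cube n)
    \sum_(i < 3) (step_up i u v + step_up i v u))).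
  by apply: leq_sum => u _; apply: leq_sum => v _; exact: neighbour_le_steps.
under eq_bigr => u _ do rewrite exchange_big.
rewrite exchange_big /=; apply: leq_sum => i _.
under eq_bigr => u _ do rewrite big_split /=.
rewrite big_split /= -addnn [X in _ + X]exchange_big /=.
by apply: leq_add; apply: leq_sum => u _; exact: sum_step_up.
Qed.

(** Induction on the number of missing vertices. The slack [edge_count Q + 6 * n ^ 2 - 6 * #|Q|] is
    nonnegative at [Q], grows by 2d - 6 when a vertex with d >= 3 neighbours is added, and is at
    most 0 at the full cube. *)
Lemma connect_percolating P Q : percolates P -> #|P| <= n ^ 2 -> P \subset Q ->
  6 * #|Q| <= edge_count Q + 6 * n ^ 2 ->
  edge_count Q + 6 * n ^ 2 = 6 * #|Q| /\
  connect (@dismantling_move n) [set: cube n] Q.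
Proof.
move=> percP cardP; have [m] := ubnP #|~: Q|; elim: m Q => // m IH Q ltm sPQ le6.
case: (boolP [exists v, (2 < degree_in Q v) && (v \notin Q)]); last first.
  move/existsPn => noadd.
  have QT : Q = setT.
    by apply: percP => // v lt2; move: (noadd v); rewrite lt2 /= negbK.
  rewrite QT connect0; split=> //.
  by have := edge_count_setT; move: le6; rewrite QT cardsT card_cube; lia.
case/existsP => v /andP [lt2 vQ].
have e := edge_countU1 vQ; have c := cardsU1 v Q; rewrite vQ in c.
have [|||e' cn] := IH (v |: Q).
- have := cardsC Q; have := cardsC (v |: Q); lia.
- by rewrite (subset_trans sPQ) ?subsetUr.
- by rewrite e c; lia.
(* Zero slack of [v |: Q] leaves neither slack in [Q] nor a fourth neighbour of [v]. *)
have deg3 : degree_in Q v = 3 by lia.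
split; first by lia.
apply: connect_trans cn (connect1 _); apply/existsP; exists v.
rewrite setU11 setU1K // eqxx andbT /=; apply/eqP.
by rewrite -/(degree_in (v |: Q) v) degree_inU1 // neighbour_irr.
Qed.

(** Zero slack at [P] together with the size bound forces [#|P| = n ^ 2] and no edges. *)
Lemma solution_of_percolating P : percolates P -> #|P| <= n ^ 2 -> solution P.
Proof.
move=> percP cardP.
have [|e6 cn] := connect_percolating percP cardP (subxx P); first by lia.
split=> //; split; first by lia.
have e0 : edge_count P = 0 by lia.
move=> u v uP vP; move/eqP: e0; rewrite sum_nat_eq0 => /forallP /(_ u).
rewrite uP /= degree_inE sum_nat_eq0 => /forallP /(_ v).
by rewrite vP /= eqb0.
Qed.

End Percolation.

(** * Filling the interior of a face *)

Lemma gcdn_odd_mul_exp2 t b k : b < t -> gcdn (k.*2.+1 * 2 ^ b) (2 ^ t) = 2 ^ b.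
Proof.
move=> ltbt; rewrite -(subnK (ltnW ltbt)) expnD -muln_gcdl.
suff /eqP -> : coprime k.*2.+1 (2 ^ (t - b)) by rewrite mul1n.
by rewrite coprimeXr // coprimen2 /= odd_double.
Qed.

Lemma exp2_ndvd_or_odd_mul b x : ~~ (2 ^ b.+1 %| x) ->
  ~~ (2 ^ b %| x) \/ exists k, x = k.*2.+1 * 2 ^ b.
Proof.
case: (boolP (2 ^ b %| x)) => [/dvdnP [q ->]|_ _]; last by left.
rewrite expnS dvdn_pmul2r ?expn_gt0 // dvdn2 negbK => odd_q.
by right; exists q./2; rewrite -[in LHS](odd_double_half q) odd_q.
Qed.

Section Face.

Variable t : nat.
Let n := 2 ^ t.

(** A point fills from one neighbour beside it and the two above and below, all off the axes. *)
Definition row_closed (F : nat -> nat -> Prop) := forall x x' y,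
  0 < x < n -> 0 < x' < n -> x = x'.+1 \/ x' = x.+1 -> 1 < y -> y.+1 < n ->
  F x' y -> F x y.-1 -> F x y.+1 -> F x y.

Definition has_diagonals (F : nat -> nat -> Prop) := forall x y,
  0 < x < n -> 0 < y < n -> gcdn x n = gcdn y n -> F x y.

Lemma row_fill (F : nat -> nat -> Prop) b k x :
  has_diagonals F -> row_closed F -> b < t ->
  (forall x y, 0 < x < n -> 0 < y < n ->
     ~~ (2 ^ b %| x) -> ~~ (2 ^ b %| y) -> F x y) ->
  k.*2.+1 * 2 ^ b < n -> 0 < x < n -> ~~ (2 ^ b %| x) -> F x (k.*2.+1 * 2 ^ b).
Proof.
move=> diagF rowF ltbt IH; set y := k.*2.+1 * 2 ^ b => lt_yn lt_xn ndvd.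
(* 2^0 divides everything, so b > 0; hence y and n are even. *)
have b_gt0 : 0 < b by rewrite lt0n; apply: contraNneq ndvd => ->; rewrite dvd1n.
have gy : gcdn y n = 2 ^ b by exact: gcdn_odd_mul_exp2.
have eb : 2 ^ b = (2 ^ b.-1).*2 by rewrite -mul2n -expnS prednK.
have en : n = 2 ^ (t - b) * 2 ^ b by rewrite -expnD subnK // ltnW.
have ec : 2 ^ (t - b) = (2 ^ (t - b).-1).*2.
  by rewrite -mul2n -expnS prednK // subn_gt0.
have odd_y : ~~ odd y by rewrite /y eb oddM odd_double andbF.
have odd_n : ~~ odd n by rewrite en eb oddM odd_double andbF.
have y_gt0 : 0 < y by rewrite muln_gt0 expn_gt0.
have ndvd_odd z : odd z -> ~~ (2 ^ b %| z).
  move=> odd_z; apply: contraL odd_z => /(dvdn_trans (_ : 2 %| 2 ^ b)).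
  by rewrite eb dvdn2 odd_double dvdn2 => /(_ isT).
(* The points above and below lie in odd rows, filled by [IH]; evenness of y and n keeps them inside
   the open face. *)
have stepF x1 x2 : 0 < x1 < n -> 0 < x2 < n -> x1 = x2.+1 \/ x2 = x1.+1 ->
    ~~ (2 ^ b %| x1) -> F x2 y -> F x1 y.
  move=> l1 l2 e12 nd1 F2; apply: rowF F2 _ _ => //.
  - by lia.
  - by lia.
  - by apply: IH; [| lia | | apply: ndvd_odd; lia].
  - by apply: IH; [| lia | | apply: ndvd_odd; lia].
have around j d : j.*2.+1 * 2 ^ b < n -> d < 2 ^ b ->
    F (j.*2.+1 * 2 ^ b + d) y /\ F (j.*2.+1 * 2 ^ b - d) y.
  (* n is an even multiple of 2^b, so the segment to the right of an odd multiple stays within the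
     face. *)
  move=> lt_jn; have le_jn : j.*2.+2 * 2 ^ b <= n.
    by rewrite en leq_mul2r ec -doubleS leq_double; move: lt_jn;
      rewrite en ltn_mul2r ec => /andP [_]; lia.
  elim: d => [|d IHd] lt_d.
    rewrite addn0 subn0; suff Fj : F (j.*2.+1 * 2 ^ b) y by [].
    apply: diagF; [by rewrite lt_jn andbT muln_gt0 expn_gt0 | by lia |].
    by rewrite gy gcdn_odd_mul_exp2.
  have le_b : 2 ^ b <= j.*2.+1 * 2 ^ b by rewrite leq_pmull.
  rewrite mulSn in le_jn.
  have [Fp Fm] := IHd (ltnW lt_d); split.
  - apply: stepF Fp; [lia | lia | lia |].
    by rewrite dvdn_addr ?dvdn_mull // gtnNdvd.
  - apply: stepF Fm; [lia | lia | lia |].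
    rewrite dvdn_subr ?dvdn_mull //; last exact: leq_trans (ltnW lt_d) le_b.
    by rewrite gtnNdvd.
(* With x = q 2^b + r, the row fills towards x from q 2^b if q is odd, from (q+1) 2^b if q is
   even. *)
have ex := divn_eq x (2 ^ b); set q := x %/ 2 ^ b in ex.
have lt_r : x %% 2 ^ b < 2 ^ b by rewrite ltn_mod expn_gt0.
have r_gt0 : 0 < x %% 2 ^ b by rewrite lt0n.
set r := x %% 2 ^ b in ex lt_r r_gt0.
have lt_q : q < 2 ^ (t - b).
  by rewrite -(ltn_pmul2r (expn_gt0 2 b)) -en; lia.
have eq := odd_double_half q; case: (boolP (odd q)) eq => _ eq.
  have [|+ _] := around q./2 r _ lt_r.
    rewrite [q./2.*2.+1]eq; case/andP: lt_xn => _.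
    by apply: leq_ltn_trans; rewrite ex leq_addr.
  by rewrite [q./2.*2.+1]eq -ex.
have {}eq : q./2.*2.+1 = q.+1 by rewrite -[in RHS]eq.
have [||_] := around q./2 (2 ^ b - r); rewrite ?eq.
- by rewrite en ltn_pmul2r ?expn_gt0 // ec in lt_q *; lia.
- by lia.
by rewrite mulSn; congr (F _ y); lia.
Qed.

(** Induction on b fills the points whose coordinates are both not divisible by 2^b; b = t covers
    the open face. A new coordinate is an odd multiple of 2^b: one such coordinate is a row or
    column fill, two give a diagonal point. *)
Lemma face_fill (F : nat -> nat -> Prop) :
  has_diagonals F -> row_closed F -> row_closed (fun x y => F y x) ->
  forall x y, 0 < x < n -> 0 < y < n -> F x y.
Proof.
move=> diagF rowF colF.
have diagF' : has_diagonals (fun x y => F y x).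
  by move=> x y lx ly e; apply: diagF.
suff main b : b <= t -> forall x y, 0 < x < n -> 0 < y < n ->
    ~~ (2 ^ b %| x) -> ~~ (2 ^ b %| y) -> F x y.
  by move=> x y lx ly; apply: (main t) => //; rewrite gtnNdvd //; lia.
elim: b => [|b IH] ltbt x y lx ly; first by rewrite dvd1n.
move=> /exp2_ndvd_or_odd_mul dx /exp2_ndvd_or_odd_mul dy.
have {}IH := IH (ltnW ltbt).
case: dx => [dx|[j ej]]; case: dy => [dy|[k ek]].
- exact: IH.
- by rewrite ek; apply: row_fill => //; rewrite -ek; lia.
- rewrite ej; apply: (row_fill diagF' colF ltbt) => //; last by rewrite -ej; lia.
  by move=> x' y' *; apply: IH.
- by apply: diagF; rewrite // ej ek !gcdn_odd_mul_exp2.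
Qed.

End Face.

(** * Filling the box, on triples of naturals *)

Definition cube_of n (p : nat * nat * nat) : cube n.+1 :=
  [ffun i : 'I_3 => inord (nth 0 [:: p.1.1; p.1.2; p.2] i)].

(** Rules out the out-of-range values that [inord] in [cube_of] sends to 0. *)
Definition in_box n (p : nat * nat * nat) := [&& p.1.1 < n, p.1.2 < n & p.2 < n].

(** The l1 distance: with truncated subtraction, each bracket is an absolute difference. *)
Definition dist (p q : nat * nat * nat) :=
  (p.1.1 - q.1.1) + (q.1.1 - p.1.1) + ((p.1.2 - q.1.2) + (q.1.2 - p.1.2))
  + ((p.2 - q.2) + (q.2 - p.2)).

Definition box_closed n (A : nat * nat * nat -> Prop) := forall p q1 q2 q3,
  [&& in_box n p, in_box n q1, in_box n q2 & in_box n q3] ->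
  [&& dist p q1 == 1, dist p q2 == 1 & dist p q3 == 1] ->
  [&& 0 < dist q1 q2, 0 < dist q1 q3 & 0 < dist q2 q3] ->
  A q1 -> A q2 -> A q3 -> A p.

Lemma box_fill t (A : nat * nat * nat -> Prop) :
  0 < t -> box_closed (2 ^ t) A -> A (0, 0, 0) ->
  has_diagonals t (fun x y => A (x, y, 0)) ->
  has_diagonals t (fun x z => A (x, 0, z)) ->
  has_diagonals t (fun y z => A (0, y, z)) ->
  forall p, in_box (2 ^ t) p -> A p.
Proof.
move=> t_gt0 closA A0 dz dy dx.
(* The axes fill with the help of points having a coordinate 1, which must lie in the box. *)
have n_gt1 : 1 < 2 ^ t by rewrite -{1}(expn0 2) ltn_exp2l.
have fz x y : 0 < x < 2 ^ t -> 0 < y < 2 ^ t -> A (x, y, 0).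
  apply: (face_fill dz) => x1 x2 y1 *.
    by apply: (closA _ (x2, y1, 0) (x1, y1.-1, 0) (x1, y1.+1, 0)) => //;
      rewrite /in_box /dist /=; lia.
  by apply: (closA _ (y1, x2, 0) (y1.-1, x1, 0) (y1.+1, x1, 0)) => //;
    rewrite /in_box /dist /=; lia.
have fy x z : 0 < x < 2 ^ t -> 0 < z < 2 ^ t -> A (x, 0, z).
  apply: (face_fill dy) => x1 x2 y1 *.
    by apply: (closA _ (x2, 0, y1) (x1, 0, y1.-1) (x1, 0, y1.+1)) => //;
      rewrite /in_box /dist /=; lia.
  by apply: (closA _ (y1, 0, x2) (y1.-1, 0, x1) (y1.+1, 0, x1)) => //;
    rewrite /in_box /dist /=; lia.
have fx y z : 0 < y < 2 ^ t -> 0 < z < 2 ^ t -> A (0, y, z).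
  apply: (face_fill dx) => x1 x2 y1 *.
    by apply: (closA _ (0, x2, y1) (0, x1, y1.-1) (0, x1, y1.+1)) => //;
      rewrite /in_box /dist /=; lia.
  by apply: (closA _ (0, y1, x2) (0, y1.-1, x1) (0, y1.+1, x1)) => //;
    rewrite /in_box /dist /=; lia.
have ax x : x < 2 ^ t -> A (x, 0, 0).
  elim: x => // x IH lt_x.
  apply: (closA _ (x, 0, 0) (x.+1, 1, 0) (x.+1, 0, 1)).
  1-3: by rewrite /in_box /dist /=; lia.
  - by apply: IH; lia.
  - by apply: fz; lia.
  - by apply: fy; lia.
have ay y : y < 2 ^ t -> A (0, y, 0).
  elim: y => // y IH lt_y.
  apply: (closA _ (0, y, 0) (1, y.+1, 0) (0, y.+1, 1)).
  1-3: by rewrite /in_box /dist /=; lia.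
  - by apply: IH; lia.
  - by apply: fz; lia.
  - by apply: fx; lia.
have az z : z < 2 ^ t -> A (0, 0, z).
  elim: z => // z IH lt_z.
  apply: (closA _ (0, 0, z) (1, 0, z.+1) (0, 1, z.+1)).
  1-3: by rewrite /in_box /dist /=; lia.
  - by apply: IH; lia.
  - by apply: fy; lia.
  - by apply: fx; lia.
move=> [[x y] z] /and3P [/=].
elim: x y z => [|x IHx] y z lx.
  by case: y => [|y] ly; [exact: az | case: z => [|z] lz; [exact: ay | exact: fx]].
elim: y z => [|y IHy] z ly.
  by case: z => [|z] lz; [exact: ax | exact: fy].
elim: z => [|z IHz] lz; first exact: fz.
apply: (closA _ (x, y.+1, z.+1) (x.+1, y, z.+1) (x.+1, y.+1, z)).
1-3: by rewrite /in_box /dist /=; lia.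
- by apply: IHx => //; lia.
- by apply: IHy => //; lia.
- by apply: IHz; lia.
Qed.

(** * From triples back to cubes *)

Definition i0 : 'I_3 := ord0.
Definition i1 : 'I_3 := @Ordinal 3 1 isT.
Definition i2 : 'I_3 := @Ordinal 3 2 isT.

Lemma cube_ofE n (p : nat * nat * nat) : in_box n.+1 p ->
  [/\ cube_of n p i0 = p.1.1 :> nat, cube_of n p i1 = p.1.2 :> nat
    & cube_of n p i2 = p.2 :> nat].
Proof. by case/and3P => lx ly lz; rewrite !ffunE /= !inordK. Qed.

Lemma ord3P (P : 'I_3 -> Prop) : P i0 -> P i1 -> P i2 -> forall i, P i.
Proof.
move=> P0 P1 P2 [[|[|[|//]]] lti].
- by rewrite (_ : Ordinal lti = i0) //; apply: val_inj.
- by rewrite (_ : Ordinal lti = i1) //; apply: val_inj.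
- by rewrite (_ : Ordinal lti = i2) //; apply: val_inj.
Qed.

Lemma cube_of_coord n (v : cube n.+1) :
  v = cube_of n (v i0 : nat, v i1 : nat, v i2 : nat).
Proof. by apply/ffunP; apply: ord3P; apply: val_inj; rewrite ffunE /= inordK. Qed.

Lemma neighbour_cube_of n p q : in_box n.+1 p -> in_box n.+1 q ->
  dist p q = 1 -> neighbour (cube_of n p) (cube_of n q).
Proof.
move=> /cube_ofE [p0 p1 p2] /cube_ofE [q0 q1 q2]; rewrite /dist => d1.
have nb i : ((cube_of n p i).+1 == cube_of n q i :> nat) ||
      ((cube_of n q i).+1 == cube_of n p i :> nat) ->
    (forall j, j != i -> cube_of n p j = cube_of n q j :> nat) ->
    neighbour (cube_of n p) (cube_of n q).
  move=> h e; apply/existsP; exists i; rewrite h.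
  by apply/forallP => j; apply/implyP => /e /val_inj ->.
have [e1|ne1] := eqVneq p.1.2 q.1.2; last first.
  by apply: (nb i1); [lia | apply: ord3P => // _; lia].
have [e2|ne2] := eqVneq p.2 q.2; last first.
  by apply: (nb i2); [lia | apply: ord3P => // _; lia].
by apply: (nb i0); [lia | apply: ord3P => // _; lia].
Qed.

Lemma box_closed_of_degree n (Q : position n.+1) :
  (forall v, 2 < degree_in Q v -> v \in Q) ->
  box_closed n.+1 (fun p => cube_of n p \in Q).
Proof.
move=> closQ p q1 q2 q3 /and4P [bp b1 b2 b3].
move=> /and3P [/eqP d1 /eqP d2 /eqP d3] /and3P [d12 d13 d23] Q1 Q2 Q3.
apply: closQ; rewrite /degree_in.
have inj q q' : in_box n.+1 q -> in_box n.+1 q' -> 0 < dist q q' ->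
    cube_of n q != cube_of n q'.
  move=> bq bq'; apply: contraTneq => e.
  have [e0 e1 e2] := cube_ofE bq; have [e0' e1' e2'] := cube_ofE bq'.
  by rewrite e in e0 e1 e2; rewrite /dist; lia.
have u3 : uniq [:: cube_of n q1; cube_of n q2; cube_of n q3].
  by rewrite /= !inE negb_or !inj.
rewrite -/(size [:: cube_of n q1; cube_of n q2; cube_of n q3]) -(card_uniqP u3).
apply/subset_leq_card/subsetP => v; rewrite !inE.
by case/or3P => /eqP ->; rewrite ?Q1 ?Q2 ?Q3 neighbour_cube_of.
Qed.

(** * The facial set: percolation and size *)

(* [gcdn x n] encodes the 2-adic valuation of x capped at t, including
   [gcdn 0 n = n]. *)
Definition facial_solution n : position n.+1 := [set v : cube n.+1 |
  [|| (v i2 == 0 :> nat) && (gcdn (v i0) n.+1 == gcdn (v i1) n.+1),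
      (v i1 == 0 :> nat) && (gcdn (v i0) n.+1 == gcdn (v i2) n.+1)
    | (v i0 == 0 :> nat) && (gcdn (v i1) n.+1 == gcdn (v i2) n.+1)]].

Lemma percolates_facial_solution t n : 0 < t -> n.+1 = 2 ^ t ->
  percolates (facial_solution n).
Proof.
move=> t_gt0 en Q sIQ closQ; apply/setP => v; rewrite in_setT [v]cube_of_coord.
have mem p : in_box n.+1 p ->
    [|| (p.2 == 0) && (gcdn p.1.1 n.+1 == gcdn p.1.2 n.+1),
      (p.1.2 == 0) && (gcdn p.1.1 n.+1 == gcdn p.2 n.+1)
    | (p.1.1 == 0) && (gcdn p.1.2 n.+1 == gcdn p.2 n.+1)] -> cube_of n p \in Q.
  move=> bp h; apply: (subsetP sIQ); rewrite inE.
  by have [-> -> ->] := cube_ofE bp.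
apply: (box_fill t_gt0 (A := fun p => cube_of n p \in Q)); rewrite -?en.
- exact: box_closed_of_degree.
- by apply: mem; rewrite /= ?eqxx.
- move=> x y; rewrite -en => lx ly e; apply: mem; rewrite /in_box /=; first by lia.
  by rewrite e eqxx.
- move=> x y; rewrite -en => lx ly e; apply: mem; rewrite /in_box /=; first by lia.
  by rewrite e eqxx orbT.
- move=> x y; rewrite -en => lx ly e; apply: mem; rewrite /in_box /=; first by lia.
  by rewrite e eqxx !orbT.
by rewrite /in_box /= !ltn_ord.
Qed.

(** If 2^c is the common gcd, then y is an odd multiple of 2^c and y - 2^c an even one, possibly 0,
    whose gcd is 2^t > 2^c. This provides preimages in the counting below. *)
Lemma gcdn_exp2_lt_sub t x y : 0 < x < 2 ^ t -> 0 < y < 2 ^ t ->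
  gcdn x (2 ^ t) = gcdn y (2 ^ t) ->
  gcdn x (2 ^ t) <= y /\ gcdn x (2 ^ t) < gcdn (y - gcdn x (2 ^ t)) (2 ^ t).
Proof.
have odd_part b z : 0 < z < 2 ^ t -> b <= t -> ~~ (2 ^ b %| z) ->
    exists c k, [/\ c < t & z = k.*2.+1 * 2 ^ c].
  move=> lz; elim: b => [|b IH]; first by rewrite dvd1n.
  move=> lt_bt /exp2_ndvd_or_odd_mul [/IH|[k ->]]; first by apply; exact: ltnW.
  by exists b, k.
move=> lx ly.
have [|c [j [lt_ct ->]]] := odd_part t x lx (leqnn t).
  by rewrite gtnNdvd //; lia.
have [|d [k [lt_dt ->]]] := odd_part t y ly (leqnn t).
  by rewrite gtnNdvd //; lia.
rewrite !gcdn_odd_mul_exp2 // => ->; split; first by rewrite leq_pmull.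
rewrite mulSn addKn -doubleMl doubleMr -mul2n -expnS.
apply: leq_trans (dvdn_leq _ (_ : 2 ^ d.+1 %| _)).
- by rewrite ltn_exp2l.
- by rewrite gcdn_gt0 expn_gt0 orbT.
- by rewrite dvdn_gcd dvdn_mull //= dvdn_exp2l.
Qed.

(** The set lies in the image of the pairs of coordinates under a map. *)
Lemma card_facial_solution t n : n.+1 = 2 ^ t -> #|facial_solution n| <= n.+1 ^ 2.
Proof.
move=> en; pose g x := gcdn x n.+1.
(* Decreasing one coordinate of a point of a face by its power of 2 makes the
   valuations differ, and which of them is larger tells the face. *)
pose h x y := if g x == g y then (x, y, 0)
  else if g x < g y then (x, 0, y + g x) else (0, x + g y, y).
have -> : n.+1 ^ 2 = #|{: 'I_n.+1 * 'I_n.+1}| by rewrite card_prod !card_ord.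
rewrite -cardsT.
apply: leq_trans
  (leq_imset_card (fun a : 'I_n.+1 * 'I_n.+1 => cube_of n (h a.1 a.2)) _).
apply/subset_leq_card/subsetP => v; rewrite inE => vI; apply/imsetP.
suff [x [y [lx ly e]]] : exists x y, [/\ x < n.+1, y < n.+1
    & h x y = (v i0 : nat, v i1 : nat, v i2 : nat)].
  exists (inord x, inord y); first by rewrite inE.
  by rewrite [v]cube_of_coord -e /= !inordK.
move: (v i0 : nat) (v i1 : nat) (v i2 : nat) (ltn_ord (v i0)) (ltn_ord (v i1))
  (ltn_ord (v i2)) vI => x y z lx ly lz.
(* Below n+1 only 0 has gcd n+1, so the origin is the only point of the set on an axis. *)
have gn w : w < n.+1 -> g w = g 0 -> w = 0.
  rewrite /g gcd0n; case: w => // w lw e.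
  by have := dvdn_leq (ltn0Sn w) (dvdn_gcdl w.+1 n.+1); rewrite e; lia.
have sub_lt a b : 0 < a < n.+1 -> b < n.+1 -> g a = g b ->
    g a <= b /\ g a < g (b - g a).
  case: b => [/andP [a0 la] lb /(gn _ la)|b la lb]; first by lia.
  by move: la lb; rewrite /g en => la lb; apply: gcdn_exp2_lt_sub.
rewrite -!/(g _) => /or3P [] /andP [/eqP -> /eqP e].
- by exists x, y; rewrite /h e eqxx.
- have [x0|x_gt0] := posnP x.
    have z0 : z = 0 by apply: gn; rewrite // -e x0.
    by exists 0, 0; rewrite /h eqxx x0 z0.
  (* Subtracting [g x] from z makes the second valuation the larger one, which selects the second
     branch of [h]; the face x = 0 uses the third. *)
  have [|le_z lt_g] := sub_lt x z _ lz e; first by rewrite x_gt0.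
  exists x, (z - g x); split=> //; first by lia.
  by rewrite /h ltn_eqF // lt_g subnK.
have [z0|z_gt0] := posnP z.
  have y0 : y = 0 by apply: gn; rewrite // e z0.
  by exists 0, 0; rewrite /h eqxx y0 z0.
have [|le_y lt_g] := sub_lt z y _ ly (esym e); first by rewrite z_gt0.
exists (y - g z), z; split=> //; first by lia.
by rewrite /h gtn_eqF // ltnNge (ltnW lt_g) /= subnK.
Qed.

Theorem lemma4 (t n : nat) (ht : 1 <= t) (hn : n = 2 ^ t) :
  exists I : position n,
    solution I /\
    exists s1 s2 s3 : section n,
      [/\ facial s1, facial s2 & facial s3] /\
      [/\ orthogonal s1 s2, orthogonal s1 s3 & orthogonal s2 s3] /\
      I \subset section_set s1 :|: section_set s2 :|: section_set s3.
Proof.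
case: n hn => [/esym/eqP|n hn]; first by rewrite expn_eq0.
exists (facial_solution n); split.
  apply: solution_of_percolating; first exact: percolates_facial_solution hn.
  exact: card_facial_solution hn.
exists (i0, ord0), (i1, ord0), (i2, ord0); split; [|split].
- by split; left.
- by split.
apply/subsetP => v; rewrite !inE /= -!val_eqE /=.
by case/or3P => /andP [-> _]; rewrite ?orbT.
Qed.
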